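(* Let $\{(V_i,X_i,d_i)\}_{i\in I}$ be a family of continuity spaces. Put $X=\prod_{i\in I}X_i$, with projections $\pi_i$, let $U=\left[\prod_0 (V_i)_\prec\right]^X$, $V=\Omega(U)$, and define $d:X\times X\to V$ by $$d(a,b)=\{A\in[U]^{<\omega}\mid \text{for every } R\in A \text{ there is a walk } w(a,b) \text{ in } X \text{ from } a \text{ to } b \text{ with } R\vdash w(a,b)\}.$$ Then $$(V,X,d)=\prod_{i\in I}(V_i,X_i,d_i).$$ That is, $\mathcal{O}[(V,X,d)]$ is the (topological) product of the family $\{\mathcal{O}[(V_i,X_i,d_i)]\}_{i\in I}$.
   Context: For a complete lattice $L$ with bottom $\bot$ and top $\top$ and $x,y\in L$, write $y\succ x$ (equivalently $x\prec y$; ''$y$ is well above $x$'') if whenever $S\subseteq L$ and $x\ge\bigwedge S$, there is $s\in S$ with $y\ge s$. A complete lattice is completely distributive if arbitrary joins distribute over arbitrary meets. A value distributive lattice is a completely distributive complete lattice $L$ for which $L_\prec=\{a\in L\mid a\succ\bot\}$ is a filter. A value quantale is a value distributive lattice $V$ with an associative commutative binary operation $+:V\times V\to V$ such that $x+\bot=x$ for all $x\in V$ and $\bigwedge(x+S)=x+\bigwedge S$ for all $x\in V$, $S\subseteq V$. A continuity space $(V,X,d)$ consists of a value quantale $V$, a set $X$ and a function $d:X\times X\to V$ with $d(x,x)=\bot$ and $d(x,z)\le d(x,y)+d(y,z)$ for all $x,y,z\in X$. Continuity spaces form a category, a morphism $(V,X,d)\to(W,Y,m)$ being a function $f:X\to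 Y$ such that for every $x\in X$ and $\epsilon\in W_\prec$ there is $\delta\in V_\prec$ such that for all $x'\in X$, $d(x,x')\prec\delta$ implies $m(f(x),f(x'))\prec\epsilon$. For $\epsilon\succ\bot$ the open ball is $B_\epsilon(x)=\{y\in X\mid d(x,y)\prec\epsilon\}$. The topology $\mathcal{O}[(V,X,d)]$ generated by $(V,X,d)$ consists of those $O\subseteq X$ such that for every $x\in O$ there is $\epsilon\succ\bot$ with $B_\epsilon(x)\subseteq O$. For a set $Y$, $[Y]^{<\omega}$ is the set of finite subsets of $Y$, and $\Omega(Y)$ is the set of all $A\subseteq[Y]^{<\omega}$ that are downwards closed ($B\subseteq C\in A$ implies $B\in A$). Ordered by reverse inclusion, with $+$ given by intersection, $\Omega(Y)$ is a value quantale in which $p\succ\bot$ if and only if $p$ is finite. $\prod_0 (V_i)_\prec$ is the set of tuples in $\prod_{i\in I}(V_i)_\prec$ all but finitely many of whose coordinates equal $\top_i$, the top element of $V_i$; $\pi_i$ also denotes its $i$-th coordinate projection. $U$ is the set of all functions $X\to\prod_0(V_i)_\prec$. A walk in a set, from $a$ to $b$, is a finite sequence $a=x_1,\dots,x_n=b$ of points of it. For a continuity space $(W,Y,m)$ and $Q\subseteq W_\prec\times Y$, $Q$ admits the walk $y_1,\dots,y_n$ in $Y$ if for every $k\le n-1$ there is $(\epsilon,y_k)\in Q$ with $y_{k+1}\in B_\epsilon(y_k)$. For $R\in U$ and a walk $w=(x_1,\dots,x_n)$ in $X$, $R\vdash w$ means that for each $i\in I$ the set $\{(\pi_i(R(x_k)),\pi_i(x_k))\mid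 1\le k\le n\}$ admits the walk $\pi_i(x_1),\dots,\pi_i(x_n)$ in $(V_i,X_i,d_i)$.
   Formalization: In the definition of ''Q admits a walk'', a pair (ε, y_k) with ε equal to the top element allows any next point y_{k+1} (that is, B_⊤(x) is read as the whole space); with the literal ball of radius ⊤ the claim fails for infinite I. *)

(* Defs.v *)
From HB Require Import structures.
From mathcomp Require Import all_boot all_order.
From mathcomp Require Import all_classical.
From mathcomp Require Import topology.

Set Implicit Arguments.
Unset Strict Implicit.
Unset Printing Implicit Defensive.

Import Order.TTheory.

Local Open Scope classical_set_scope.
Local Open Scope order_scope.

HB.mixin Record hasSetMeet d (L : Type) of Order.TBLattice d L := {
  Meet : set L -> L;
  Meet_lb : forall (S : set L) (x : L), S x -> Meet S <= x;
  Meet_glb : forall (S : set L) (y : L),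
    (forall x, S x -> y <= x) -> y <= Meet S
}.

#[short(type="completeLatticeType")]
HB.structure Definition CompleteLattice d :=
  { L of hasSetMeet d L & Order.TBLattice d L }.

Section CompleteLatticeDefs.
Context {d : Order.disp_t} {L : completeLatticeType d}.
Implicit Types (x y : L) (S F : set L).

Definition Join S : L := Meet [set y | forall x, S x -> x <= y].

(* Arbitrary joins distribute over arbitrary meets; the families may be
   empty. *)
Definition completely_distributive :=
  forall (J : Type) (K : J -> Type) (x : forall j, K j -> L),
    Join (range (fun j => Meet (range (x j)))) =
    Meet (range (fun f : forall j, K j => Join (range (fun j => x j (f j))))).

(* [S] ranges over all subsets, the empty one included, so that nothing is
   well above [\top]. *)
Definition well_below x y :=
  forall S, Meet S <= x -> exists2 s, S s & s <= y.

(* Filters need not be proper: [\bot] may be well above itself. *)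
Definition is_filter F :=
  [/\ exists x, F x,
      forall x y, x <= y -> F x -> F y &
      forall x y, F x -> F y -> F (Order.meet x y)].

End CompleteLatticeDefs.

Arguments completely_distributive {d} L.

Notation "x ≺ y" := (well_below x y) (at level 70, no associativity).

HB.mixin Record isValueDistributive d (L : Type) of CompleteLattice d L := {
  complete_distr : completely_distributive L;
  pos_filter : is_filter [set x : L | \bot ≺ x]
}.

#[short(type="valueDistrLatticeType")]
HB.structure Definition ValueDistrLattice d :=
  { L of isValueDistributive d L & CompleteLattice d L }.

HB.mixin Record hasValueAdd d (V : Type) of ValueDistrLattice d V := {
  vadd : V -> V -> V;
  vaddA : associative vadd;
  vaddC : commutative vadd;
  vaddx0 : right_id \bot vadd;
  Meet_vadd : forall (x : V) (S : set V),
    Meet [set vadd x s | s in S] = vadd x (Meet S)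
}.

#[short(type="valueQuantaleType")]
HB.structure Definition ValueQuantale d :=
  { V of hasValueAdd d V & ValueDistrLattice d V }.

Notation "x ⊕ y" := (vadd x y) (at level 50, left associativity).

Definition pos_of d (V : valueQuantaleType d) := {e : V | \bot ≺ e}.

Section WellBelowTheory.
Context {d : Order.disp_t} {L : completeLatticeType d}.
Implicit Types (x y : L).

Lemma well_below_le_trans x y z : x ≺ y -> y <= z -> x ≺ z.
Proof. by move=> xy yz S /xy[s Ss sy]; exists s => //; exact: le_trans yz. Qed.

Lemma well_below_topP x : x ≺ \top <-> x <> \top.
Proof.
split=> [xT xE | xNT S Sx].
  have [|s []] := xT set0; first by rewrite xE lex1.
have [S0|/set0P[s Ss]] := eqVneq S set0; last by exists s => //; exact: lex1.
case: xNT; apply/eqP; rewrite -le1x; apply: le_trans Sx.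
by apply: Meet_glb => y; rewrite S0.
Qed.

End WellBelowTheory.

Record continuitySpace := ContinuitySpace {
  cs_disp : Order.disp_t;
  cs_quantale : valueQuantaleType cs_disp;
  cs_sort :> choiceType;
  dist : cs_sort -> cs_sort -> cs_quantale;
  dist_refl : forall x, dist x x = \bot;
  dist_triangle : forall x y z, dist x z <= dist x y ⊕ dist y z
}.

Notation cs_pos C := (pos_of (cs_quantale C)).

Definition cs_morphism (C D : continuitySpace) (f : C -> D) :=
  forall (x : C) (e : cs_pos D), exists delta : cs_pos C,
    forall x' : C, dist x x' ≺ sval delta -> dist (f x) (f x') ≺ sval e.

Definition is_cs_product (I : Type) (C : I -> continuitySpace)
    (P : continuitySpace) (p : forall i, P -> C i) :=
  (forall i, cs_morphism (p i)) /\
  forall (Z : continuitySpace) (f : forall i, Z -> C i),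
    (forall i, cs_morphism (f i)) ->
    exists! g : Z -> P, cs_morphism g /\ forall i z, p i (g z) = f i z.

Section CsTopology.
Variable C : continuitySpace.

Definition cs_ball (x : C) (e : cs_pos C) : set C :=
  [set y | dist x y ≺ sval e].

Definition cs_open : set_system C :=
  [set O | forall x, O x -> exists e : cs_pos C, cs_ball x e `<=` O].

Lemma cs_openT : cs_open setT.
Proof.
move=> x _; have [[e e0] _ _] := @pos_filter _ (cs_quantale C).
by exists (exist _ e e0).
Qed.

Lemma cs_openI : setI_closed cs_open.
Proof.
move=> A B oA oB x [/oA[[a a0] aA] /oB[[b b0] bB]].
have [_ _ /(_ _ _ a0 b0) ab0] := @pos_filter _ (cs_quantale C).
exists (exist _ (Order.meet a b) ab0) => y xy; split.
- by apply: aA; exact: well_below_le_trans xy (leIl _ _).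
- by apply: bB; exact: well_below_le_trans xy (leIr _ _).
Qed.

Lemma cs_open_bigcup (I : Type) (A : I -> set C) :
  (forall i, cs_open (A i)) -> cs_open (\bigcup_i A i).
Proof.
by move=> oA x [i _ /oA[e eA]]; exists e => y /eA Ay; exists i.
Qed.

Definition cs_topology : Type := C.

HB.instance Definition _ := Choice.on cs_topology.
HB.instance Definition _ :=
  isOpenTopological.Build cs_topology cs_openT cs_openI cs_open_bigcup.

Lemma cs_openE : @open cs_topology = cs_open.
Proof. by []. Qed.

End CsTopology.

Definition opens (T : topologicalType) : set_system T := @open T.
Arguments opens : clear implicits.

Lemma finite_powerset (T : Type) (D : set T) :
  finite_set D -> finite_set [set B | B `<=` D].
Proof.
move: D; rewrite -[T]/({classic T} : Type) => D /finite_seqP[s ->].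
pose F (m : (size s).-tuple bool) : set {classic T} := [set` mask m s].
apply: (@sub_finite_set _ _ (range F)); last exact/finite_image/finite_finset.
move=> B Bs; exists (map_tuple (fun x => `[< B x >]) (in_tuple s)) => //.
rewrite /F /= -filter_mask; apply/seteqP; split=> x /=; rewrite mem_filter.
  by case/andP => /asboolP.
by move=> Bx; rewrite (Bs _ Bx) andbT; exact/asboolP.
Qed.

(* Ω(Y), ordered below by reverse inclusion: \bot is the set of all finite
   subsets of [Y], \top is empty, [Meet] is union and ⊕ is intersection. *)
Definition in_Omega (Y : Type) (A : set (set Y)) :=
  (forall B, A B -> finite_set B) /\ (forall B C, B `<=` C -> A C -> A B).

Definition Omega (Y : Type) := {A : set (set Y) | in_Omega A}.

Fact Omega_display : Order.disp_t. Proof. exact: (Order.Disp tt tt). Qed.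

Section OmegaQuantale.
Variable Y : Type.
Implicit Types (p q r : Omega Y) (B : set Y).

HB.instance Definition _ := gen_eqMixin (Omega Y).
HB.instance Definition _ := gen_choiceMixin (Omega Y).

Let Omega_eq p q : sval p = sval q -> p = q.
Proof.
by case: p q => [A hA] [B hB] /= AB; subst B; congr exist; exact: Prop_irrelevance.
Qed.

Definition Omega_le p q : bool := `[< sval q `<=` sval p >].

Fact Omega_le_refl : reflexive Omega_le.
Proof. by move=> p; apply/asboolP. Qed.

Fact Omega_le_anti : antisymmetric Omega_le.
Proof.
by move=> p q /andP[/asboolP qp /asboolP pq]; apply: Omega_eq; exact/seteqP.
Qed.

Fact Omega_le_trans : transitive Omega_le.
Proof.
by move=> q p r /asboolP qp /asboolP rq; apply/asboolP => B /rq /qp.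
Qed.

HB.instance Definition _ := Order.Le_isPOrder.Build Omega_display (Omega Y)
  Omega_le_refl Omega_le_anti Omega_le_trans.

Let Omega_leP p q : reflect (sval q `<=` sval p) (p <= q).
Proof. exact: asboolP. Qed.

Fact in_Omega_setU p q : in_Omega (sval p `|` sval q).
Proof.
split=> [B [] | B C BC []].
- by move: B; apply: (svalP p).1.
- by move: B; apply: (svalP q).1.
- by move/((svalP p).2 _ _ BC); left.
- by move/((svalP q).2 _ _ BC); right.
Qed.

Fact in_Omega_setI p q : in_Omega (sval p `&` sval q).
Proof.
split=> [B [/((svalP p).1 _) //] | B C BC [pC qC]].
by split; [exact: (svalP p).2 pC | exact: (svalP q).2 qC].
Qed.

Definition Omega_setU p q : Omega Y := exist _ _ (in_Omega_setU p q).
Definition Omega_setI p q : Omega Y := exist _ _ (in_Omega_setI p q).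

Fact Omega_meetP p q r : (p <= Omega_setU q r) = (p <= q) && (p <= r).
Proof.
apply/Omega_leP/andP => [|[/Omega_leP qp /Omega_leP rp]]; rewrite /= subUset.
  by move=> [qp rp]; split; exact/Omega_leP.
by split.
Qed.

Fact Omega_joinP p q r : (Omega_setI p q <= r) = (p <= r) && (q <= r).
Proof.
apply/Omega_leP/andP => [|[/Omega_leP qp /Omega_leP rp]]; rewrite /= subsetI.
  by move=> [qp rp]; split; exact/Omega_leP.
by split.
Qed.

HB.instance Definition _ := Order.POrder_MeetJoin_isLattice.Build
  Omega_display (Omega Y) Omega_meetP Omega_joinP.

Fact in_Omega_finite : in_Omega [set B : set Y | finite_set B].
Proof. by split=> // B C BC fC; exact: sub_finite_set fC. Qed.

Fact in_Omega_set0 : in_Omega (set0 : set (set Y)).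
Proof. by []. Qed.

Fact Omega_le0x p : (exist _ _ in_Omega_finite : Omega Y) <= p.
Proof. by apply/Omega_leP; exact: (svalP p).1. Qed.

Fact Omega_lex1 p : p <= (exist _ _ in_Omega_set0 : Omega Y).
Proof. by apply/Omega_leP; exact: sub0set. Qed.

HB.instance Definition _ :=
  Order.hasBottom.Build Omega_display (Omega Y) Omega_le0x.
HB.instance Definition _ :=
  Order.hasTop.Build Omega_display (Omega Y) Omega_lex1.

Fact in_Omega_bigcup (S : set (Omega Y)) :
  in_Omega (\bigcup_(p in S) sval p).
Proof.
split=> [B [p _ /((svalP p).1 _)] // | B C BC [p Sp pC]].
by exists p => //; exact: (svalP p).2 pC.
Qed.

Definition Omega_Meet (S : set (Omega Y)) : Omega Y :=
  exist _ _ (in_Omega_bigcup S).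

Fact Omega_Meet_lb (S : set (Omega Y)) p : S p -> Omega_Meet S <= p.
Proof. by move=> Sp; apply/Omega_leP => B pB; exists p. Qed.

Fact Omega_Meet_glb (S : set (Omega Y)) q :
  (forall p, S p -> q <= p) -> q <= Omega_Meet S.
Proof.
by move=> qS; apply/Omega_leP => B [p /qS/Omega_leP]; exact.
Qed.

HB.instance Definition _ := hasSetMeet.Build Omega_display (Omega Y)
  Omega_Meet_lb Omega_Meet_glb.

Let Omega_MeetE (S : set (Omega Y)) B :
  sval (Meet S) B <-> exists2 p, S p & sval p B.
Proof. by []. Qed.

Let Omega_JoinE (S : set (Omega Y)) B :
  sval (Join S) B <-> finite_set B /\ forall p, S p -> sval p B.
Proof.
split=> [BJ|[fB SB]].
  split; first by move: BJ; apply: (svalP (Join S)).1.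
  by case/Omega_MeetE: BJ => q qS qB p /qS/Omega_leP; exact.
pose A := [set B | finite_set B /\ forall p, S p -> sval p B].
have hA : in_Omega A.
  split=> [C [] // | C D CD [fD SD]]; split; first exact: sub_finite_set fD.
  by move=> p /SD; exact: (svalP p).2.
apply/Omega_MeetE; exists (exist _ A hA) => // p Sp.
by apply/Omega_leP => C [_]; exact.
Qed.

Fact Omega_complete_distr : completely_distributive (Omega Y).
Proof.
move=> J K x; apply: Omega_eq; apply/seteqP; split=> B.
  case/Omega_JoinE => fB H.
  have {}H j : {k | sval (x j k) B}.
    apply: cid.
    have /Omega_MeetE[_ [k _ <-]] := H _ (ex_intro2 _ _ j I erefl).
    by exists k.
  apply/Omega_MeetE; eexists; first by exists (fun j => sval (H j)).
  by apply/Omega_JoinE; split=> // _ [j _ <-]; exact: (svalP (H j)).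
case/Omega_MeetE => _ [f _ <-] /Omega_JoinE[fB H].
apply/Omega_JoinE; split=> // _ [j _ <-]; apply/Omega_MeetE.
by exists (x j (f j)); [exists (f j) | apply: H; exists j].
Qed.

Lemma Omega_posP p : \bot ≺ p <-> finite_set (sval p).
Proof.
split=> [p0 | fp S S0].
  have fD (D : set Y) : finite_set D -> in_Omega [set B | B `<=` D].
    split=> [B BD|B C BC CD]; first exact: sub_finite_set BD _.
    exact: subset_trans CD.
  pose S := [set q : Omega Y |
    exists2 D : set Y, finite_set D & sval q = [set B | B `<=` D]].
  have [|q [D finD qE] /Omega_leP pq] := p0 S.
    apply/Omega_leP => D finD; apply/Omega_MeetE.
    by exists (exist _ _ (fD D finD)) => //; exists D.
  by apply: (sub_finite_set pq); rewrite qE; exact: finite_powerset.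
have fU : finite_set (\bigcup_(B in sval p) B).
  by apply: bigcup_finite => // B; exact: (svalP p).1.
have /Omega_MeetE[s Ss sU] : sval (Meet S) (\bigcup_(B in sval p) B).
  by move/Omega_leP: S0; apply.
exists s => //; apply/Omega_leP => B pB; apply: (svalP s).2 sU.
exact: bigcup_sup.
Qed.

Fact Omega_pos_filter : is_filter [set p : Omega Y | \bot ≺ p].
Proof.
split=> [| p q pq p0 | p q /Omega_posP fp /Omega_posP fq].
- by exists \top; apply/Omega_posP; exact: finite_set0.
- exact: well_below_le_trans p0 pq.
- by apply/Omega_posP; rewrite /= finite_setU.
Qed.

HB.instance Definition _ := isValueDistributive.Build Omega_display (Omega Y)
  Omega_complete_distr Omega_pos_filter.

Fact Omega_setIA : associative Omega_setI.
Proof. by move=> p q r; apply: Omega_eq; exact: setIA. Qed.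

Fact Omega_setIC : commutative Omega_setI.
Proof. by move=> p q; apply: Omega_eq; exact: setIC. Qed.

Fact Omega_setIx0 : right_id \bot Omega_setI.
Proof.
by move=> p; apply: Omega_eq; apply/setIidPl; exact: (svalP p).1.
Qed.

Fact Omega_Meet_setI p (S : set (Omega Y)) :
  Meet [set Omega_setI p s | s in S] = Omega_setI p (Meet S).
Proof.
apply: Omega_eq; apply/seteqP; split=> B.
  by case/Omega_MeetE => _ [s Ss <-] [pB sB]; split=> //; exists s.
case=> pB [s Ss sB]; apply/Omega_MeetE.
by exists (Omega_setI p s) => //; exists s.
Qed.

HB.instance Definition _ := hasValueAdd.Build Omega_display (Omega Y)
  Omega_setIA Omega_setIC Omega_setIx0 Omega_Meet_setI.

End OmegaQuantale.

Definition walk_from_to (T : Type) (a b : T) (w : seq T) :=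
  exists2 s, w = a :: s & last a s = b.

(* A radius [\top] imposes no constraint on the next point. By
   [well_below_topP], this differs from the bare condition [cs_ball y e z] only
   when [sval e = dist y z = \top]: the ball of radius [\top] consists of the
   points at distance different from [\top]. Without this clause the
   coordinates at which a tuple of [prod0] equals [\top] would still be
   constrained; e.g. for an infinite family of two-point spaces over
   {\bot, \top} with distinct points at distance \top, [prod_cs] would be
   discrete. *)
Definition admits (W : continuitySpace) (Q : set (cs_pos W * W)) (w : seq W) :=
  sorted (fun y z : W =>
    `[< exists2 e, Q (e, y) & sval e = \top \/ cs_ball y e z >]) w.

Section Product.
Variables (I : Type) (C : I -> continuitySpace).

Let X : choiceType := forall i, C i.

Definition prod0 :=
  {t : forall i, cs_pos (C i) | finite_set [set i | sval (t i) <> \top]}.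

Definition prod_radii := X -> prod0.

Definition walk_ok (R : prod_radii) (w : seq X) :=
  forall i, admits [set (sval (R x) i, x i) | x in [set` w]]
                   [seq x i | x <- w].

Definition prod_dist_set (a b : X) : set (set prod_radii) :=
  [set A | finite_set A /\
    forall R, A R -> exists2 w, walk_from_to a b w & walk_ok R w].

Lemma in_Omega_prod_dist a b : in_Omega (prod_dist_set a b).
Proof.
split=> [A [] // | A B AB [fB HB]].
by split=> [|R /AB /HB //]; exact: sub_finite_set fB.
Qed.

Definition prod_dist (a b : X) : Omega prod_radii :=
  exist _ _ (in_Omega_prod_dist a b).

Lemma prod_dist_refl a : prod_dist a a = \bot.
Proof.
apply/eqP; rewrite -lex0; apply/asboolP => A fA; split=> // R _.
by exists [:: a]; [exists [::] | move=> i].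
Qed.

Lemma prod_dist_triangle a b c :
  prod_dist a c <= prod_dist a b ⊕ prod_dist b c.
Proof.
apply/asboolP => A [[fA Hab] [_ Hbc]]; split=> // R AR.
have [_ [s -> bE] ws] := Hab _ AR; have [_ [t -> cE] wt] := Hbc _ AR.
exists (a :: s ++ t); first by exists (s ++ t) => //; rewrite last_cat bE.
move=> i; rewrite /admits /= map_cat cat_path last_map bE.
apply/andP; split; [move: (ws i) | move: (wt i)];
  apply: sub_path => y z /asboolP[e [x xw xE] yz]; apply/asboolP;
  exists e => //; exists x => //; move: xw => /=; rewrite !inE mem_cat.
- by case/orP => ->; rewrite ?orbT.
- case/orP => [/eqP ->|->]; rewrite ?orbT //.
  by rewrite orbA -in_cons -bE mem_last.
Qed.

Definition prod_cs : continuitySpace :=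
  @ContinuitySpace _ (Omega prod_radii) X prod_dist
    prod_dist_refl prod_dist_triangle.

End Product.

(* Main.v *)
Require Import Defs.
From mathcomp Require Import all_boot all_order.
From mathcomp Require Import all_classical.
From mathcomp Require Import topology.

Set Implicit Arguments.
Unset Strict Implicit.
Unset Printing Implicit Defensive.

Import Order.TTheory.

Local Open Scope classical_set_scope.
Local Open Scope order_scope.

(** A radius of the product space is a finite family of sets of tuples
    [R : prod_radii C], so being close to [x] means being reachable from [x]
    along walks that obey each of finitely many [R].

    Product-open sets are open for [prod_cs C], because the coordinates are
    continuous ([continuous_prod_cs_coord]): if [O] is open in the [i]-th
    factor, let [R] give each point over [O] a radius at [i] whose ball stays
    in [O]. A walk obeying [R] that starts over [O] never leaves it, however
    long it is. The radius must differ from [\top], which does not constrain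
    walks; this is possible by [cs_open_neq_top].

    Conversely ([prod_cs_open_prod]), finitely many [R] are obeyed by the
    one-step walk from [x] to [y] once [y i] lies in finitely many balls around
    [x i], for finitely many [i]; this is a product neighbourhood of [x], since
    balls are open ([open_cs_ball]).

    That balls are open rests on two facts about a completely distributive
    lattice: every [x] is the meet of the elements well above it
    ([Meet_well_above]), and the relation interpolates ([well_below_interp]).
    Openness of balls also identifies morphisms with continuous maps
    ([cs_morphismP]), so that the universal property of the topological
    product transfers to [prod_cs C]. *)

(** * The well-above relation *)

Section WellBelow.
Context {d : Order.disp_t} {L : completeLatticeType d}.
Implicit Types (x y z : L) (S : set L).

Lemma well_below_le x y : x ≺ y -> x <= y.
Proof.
move=> /(_ [set x])[|_ -> //]; exact: Meet_lb.
Qed.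

Lemma le_well_below_trans x y z : x <= y -> y ≺ z -> x ≺ z.
Proof. by move=> xy yz S Sx; apply: yz; exact: le_trans xy. Qed.

Lemma Join_ub S x : S x -> x <= Join S.
Proof. by move=> Sx; apply: Meet_glb => y; exact. Qed.

Lemma Join_lub S y : (forall x, S x -> x <= y) -> Join S <= y.
Proof. by move=> Sy; exact: Meet_lb. Qed.

(** Raney's argument. Index by the sets [S] with [Meet S <= x]: the join of
    their meets is [x], as [[set x]] is one of them. By distributivity it is
    also the meet, over the choice functions [f] picking a point of each [S],
    of the joins of the [f S]; such a join is well above [x], because it lies
    above a point of each [S]. *)
Lemma Meet_well_above x :
  completely_distributive L -> Meet [set y | x ≺ y] = x.
Proof.
move=> cd; apply/eqP; rewrite eq_le; apply/andP; split; last first.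
  by apply: Meet_glb => y; exact: well_below_le.
pose J := {S : set L | Meet S <= x}.
have /= E := cd J (fun j => {s | sval j s}) (fun j s => sval s).
have rangeK (j : J) : range (fun s : {s | sval j s} => sval s) = sval j.
  by apply/seteqP; split=> [_ [[s js] _ <-] //|s js]; exists (exist _ s js).
apply: le_trans (_ : Join (range (fun j : J => Meet (sval j))) <= x); last first.
  by apply: Join_lub => _ [[S Sx] _ <-].
under [X in range X]eq_fun => j do rewrite -rangeK.
rewrite E; apply: Meet_glb => _ [f _ <-]; apply: Meet_lb => S Sx.
exists (sval (f (exist _ S Sx))); first exact: svalP (f (exist _ S Sx)).
by apply: Join_ub; exists (exist _ S Sx).
Qed.

(** Interpolation: the points [z] separated from [x] by some [r] still have
    meet [x], by applying [Meet_well_above] first at each [r] and then at [x]. *)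
Lemma well_below_interp x y :
  completely_distributive L -> x ≺ y -> exists2 r, x ≺ r & r ≺ y.
Proof.
move=> cd xy; have [|z [r xr rz] zy] := xy [set z | exists2 r, x ≺ r & r ≺ z].
  rewrite -[leRHS](Meet_well_above _ cd); apply: Meet_glb => r xr.
  rewrite -(Meet_well_above r cd); apply: Meet_glb => z rz.
  by apply: Meet_lb; exists r.
by exists r => //; exact: well_below_le_trans zy.
Qed.

End WellBelow.

(** * Radii in a value quantale *)

Section Radii.
Context {d : Order.disp_t} {V : valueQuantaleType d}.
Implicit Types (x y : V).

Lemma vadd_monor x y z : y <= z -> x ⊕ y <= x ⊕ z.
Proof.
move=> yz; have yE : Meet [set y; z] = y.
  apply/eqP; rewrite eq_le; apply/andP; split; first by apply: Meet_lb; left.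
  by apply: Meet_glb => _ [->|->].
by rewrite -[in leLHS]yE -Meet_vadd; apply: Meet_lb; exists z => //; right.
Qed.

(** Translation by [x] preserves the meet [\bot] of the radii, so that [x] is
    the meet of the [x ⊕ e]. *)
Lemma well_below_vadd x y : x ≺ y ->
  exists2 e : V, \bot ≺ e & x ⊕ e ≺ y.
Proof.
move=> xy; have cd := @complete_distr d V.
have [r xr ry] := well_below_interp cd xy.
have [|_ [e e0 <-] er] := xr [set x ⊕ e | e in [set e | \bot ≺ e]].
  by rewrite Meet_vadd (Meet_well_above _ cd) vaddx0.
by exists e => //; exact: le_well_below_trans er ry.
Qed.

Lemma top_pos : (\bot : V) ≺ \top.
Proof.
have [[e e0] _ _] := @pos_filter d V.
exact: well_below_le_trans e0 (lex1 _).
Qed.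

(** If [\top] were the only radius, it would equal the meet [\bot] of all radii,
    and nothing is well above [\top]. *)
Lemma exists_pos_neq_top : exists2 e : V, \bot ≺ e & e <> \top.
Proof.
apply: contrapT => noe; have /well_below_topP := top_pos; apply.
rewrite -[LHS](Meet_well_above _ (@complete_distr d V)).
apply/eqP; rewrite -le1x; apply: Meet_glb => e e0.
suff -> : e = \top by [].
by apply: contrapT => eT; apply: noe; exists e.
Qed.

End Radii.

(** * Balls and continuous maps *)

Section Balls.
Variable C : continuitySpace.

Lemma cs_ball_center (x : C) (e : cs_pos C) : cs_ball x e x.
Proof. by rewrite /cs_ball /= dist_refl; exact: svalP e. Qed.

Lemma open_cs_ball (x : C) (e : cs_pos C) : cs_open (cs_ball x e).
Proof.
move=> y /well_below_vadd[r r0 xyr]; exists (exist _ r r0) => z yz.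
apply: le_well_below_trans xyr; apply: le_trans (dist_triangle x y z) _.
exact/vadd_monor/well_below_le.
Qed.

Lemma nbhs_cs_ball (x : C) (e : cs_pos C) :
  nbhs (x : cs_topology C) (cs_ball x e).
Proof.
apply: (@open_nbhs_nbhs (cs_topology C)).
by split; [exact: open_cs_ball | exact: cs_ball_center].
Qed.

(** The radius [\top] is special in [admits]; it can always be avoided, as
    radii are closed under meets. *)
Lemma cs_open_neq_top (O : set C) x : cs_open O -> O x ->
  exists e : cs_pos C, sval e <> \top /\ cs_ball x e `<=` O.
Proof.
move=> oO /oO[[a a0] aO]; have [b b0 bT] := @exists_pos_neq_top _ (cs_quantale C).
have [_ _ /(_ _ _ a0 b0) ab0] := @pos_filter _ (cs_quantale C).
exists (exist _ (Order.meet a b) ab0); split => /= [abT|y xy].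
  by apply: bT; apply/eqP; rewrite -le1x -abT leIr.
by apply: aO; exact: well_below_le_trans xy (leIl _ _).
Qed.

End Balls.

Lemma cs_morphismP (C D : continuitySpace) (f : C -> D) :
  cs_morphism f <-> continuous (f : cs_topology C -> cs_topology D).
Proof.
split=> [mf|/continuousP cf x e].
  apply/continuousP => O oO; change (cs_open (f @^-1` O)).
  move=> x /(oO _)[e eO]; have [r rf] := mf x e.
  by exists r => y /rf /eO.
have cfe : cs_open (f @^-1` cs_ball (f x) e) := cf _ (@open_cs_ball D _ e).
have [r rf] := cfe x (@cs_ball_center D _ e).
by exists r.
Qed.

(** * The topological product *)

Section ProductTopology.
Variables (I : Type) (T : I -> topologicalType).

Lemma continuous_prod_coord i :
  continuous (fun x : prod_topology T => x i : T i).
Proof.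
move=> x; apply: cvg_trans (@initial_continuous _ _ (fun f : prod_topology T => f i) x).
apply: cvg_app.
have /cvg_sup/(_ i) : nbhs (x : prod_topology T) --> (x : prod_topology T) by exact: cvg_id.
exact.
Qed.

Lemma continuous_to_prod (Z : topologicalType) (f : Z -> prod_topology T) :
  (forall i, continuous (fun z => f z i)) -> continuous f.
Proof.
move=> cf z; apply/cvg_sup => i.
exact: (@continuous_comp_initial _ _ _ (fun x : prod_topology T => x i)).
Qed.

End ProductTopology.

Lemma filter_finite_bigcap (T J : Type) (F : set_system T) (D : set J)
    (f : J -> set T) :
  Filter F -> finite_set D -> (forall j, D j -> F (f j)) ->
  F (\bigcap_(j in D) f j).
Proof.
move: D f; rewrite -[J]/({classic J} : Type) => D f FF finD Ff.
rewrite -(fset_setK finD); apply: filter_bigI => j.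
by rewrite in_fset_set // inE => /Ff.
Qed.

(** * The topology of the product space *)

(** If [Meet S <= q], then some member of [S] contains the union of [p], hence
    every member of [p], being downwards closed. *)
Lemma Omega_well_below (Y : Type) (p q : Omega Y) :
  sval q (\bigcup_(B in sval p) B) -> q ≺ p.
Proof.
move=> qU S /asboolP Sq; have [s Ss sU] := Sq _ qU.
exists s => //; apply/asboolP => B pB; apply: (svalP s).2 sU.
exact: bigcup_sup.
Qed.

Lemma in_Omega_powerset (Y : Type) (D : set Y) :
  finite_set D -> in_Omega [set B | B `<=` D].
Proof.
move=> finD; split=> [B BD|B C BC CD]; first exact: sub_finite_set finD.
exact: subset_trans CD.
Qed.

Lemma path_invariant (T : Type) (e : rel T) (O : set T) x s :
  (forall y z, e y z -> O y -> O z) -> path e x s -> O x -> O (last x s).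
Proof.
move=> eO; elim: s x => //= y s IHs x /andP[exy ys] Ox.
exact: IHs ys (eO _ _ exy Ox).
Qed.

Section Product.
Variables (I : Type) (C : I -> continuitySpace).
Let X : choiceType := forall i, C i.

Definition single_radius (i : I) (e : cs_pos (C i)) (j : I) : cs_pos (C j) :=
  @eqtype.dfwith {classic I} (fun j => cs_pos (C j))
    (fun j => exist _ \top top_pos) i e j.

Lemma single_radius_in (i : I) (e : cs_pos (C i)) : single_radius e i = e.
Proof. exact: (@dfwith_in {classic I}). Qed.

Lemma finite_single_radius (i : I) (e : cs_pos (C i)) :
  finite_set [set j | sval (single_radius e j) <> \top].
Proof.
apply: (@sub_finite_set _ _ [set i]) => [j jT|]; last exact: finite_set1.
apply: contrapT => ji; apply: jT; rewrite /single_radius dfwith_out //.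
by apply/eqP => /esym.
Qed.

Definition single_prod0 (i : I) (e : cs_pos (C i)) : prod0 C :=
  exist _ (single_radius e) (finite_single_radius e).

(** A step of a walk obeying [R] may take its radius from any point of the walk
    with the same [i]-th coordinate. As the radius [R] gives at [i] depends on
    that coordinate only, it keeps the step over [O] all the same. The subsets
    of [[set R]] form one radius [p] that serves every point over [O]. *)
Lemma continuous_prod_cs_coord i :
  continuous (fun x : cs_topology (prod_cs C) => x i : cs_topology (C i)).
Proof.
apply/continuousP => O oO.
have /choice[r rO] : forall y : C i, exists e : cs_pos (C i),
    O y -> sval e <> \top /\ cs_ball y e `<=` O.
  move=> y; have [Oy|nOy] := pselect (O y).
    by have [e eO] := cs_open_neq_top oO Oy; exists e.
  by exists (exist _ \top top_pos).
pose R : prod_radii C := fun x => single_prod0 (r (x i)).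
pose p : Omega (prod_radii C) :=
  exist _ _ (in_Omega_powerset (finite_set1 R)).
have p0 : \bot ≺ p by apply/Omega_posP; exact/finite_powerset/finite_set1.
have pR : sval p [set R] by move=> ?; exact.
move=> x Ox; exists (exist _ p p0) => y.
move=> /well_below_le /asboolP /(_ _ pR)[_ /(_ R erefl)].
move=> [_ [s -> <-] /(_ i)]; rewrite /admits /= /preimage /=.
rewrite -(last_map (fun z : X => z i)) => sw.
apply: path_invariant sw Ox => y' z /asboolP[_ [x' _ [<- <-]]] yz /rO[rT rO'].
move: yz; rewrite single_radius_in => -[eT|yz]; first by case: rT.
exact: rO'.
Qed.

(** For the walk [[:: x; y]], only the radii that [R x] gives matter: those
    different from [\top] are finitely many. A radius [p] of the product space
    is a finite set of finite sets, so it involves only finitely many [R]. *)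
Lemma prod_cs_open_prod (O : set X) :
  @open (cs_topology (prod_cs C)) O ->
  @open (prod_topology (fun i => cs_topology (C i))) O.
Proof.
move=> oO; rewrite openE => x /oO[[p p0] pO].
pose D := \bigcup_(B in sval p) B.
have finD : finite_set D.
  by apply: bigcup_finite (svalP p).1; exact/Omega_posP.
pose N (R : prod_radii C) := [set i | sval (sval (R x) i) <> \top].
apply: (@filterS _ _ _ (\bigcap_(R in D) \bigcap_(i in N R)
    [set y : X | cs_ball (x i) (sval (R x) i) (y i)])); last first.
  apply: filter_finite_bigcap => // R _.
  apply: filter_finite_bigcap => [|i _]; first exact: svalP (R x).
  exact: (@continuous_prod_coord _ (fun i => cs_topology (C i))) (nbhs_cs_ball _ _).
move=> y xy; apply: pO; apply: Omega_well_below; split=> // R DR.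
exists [:: x; y]; first by exists [:: y].
move=> i; rewrite /admits /= andbT; apply/asboolP.
exists (sval (R x) i); first by exists x => //=; rewrite mem_head.
have [eT|eNT] := pselect (sval (sval (R x) i) = \top); first by left.
by right; exact: xy.
Qed.

Lemma opens_prod_cs :
  opens (cs_topology (prod_cs C)) =
    opens (prod_topology (fun i => cs_topology (C i))) :> set_system X.
Proof.
apply/seteqP; split=> O; first exact: prod_cs_open_prod.
have /continuousP := @continuous_to_prod I (fun i => cs_topology (C i))
  (cs_topology (prod_cs C)) (fun x => x) continuous_prod_cs_coord.
exact.
Qed.

Lemma continuous_to_prod_cs (Z : topologicalType) (f : Z -> X) :
  (forall i, continuous (fun z => f z i : cs_topology (C i))) ->
  continuous (f : Z -> cs_topology (prod_cs C)).
Proof.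
move=> /(@continuous_to_prod _ (fun i => cs_topology (C i)))/continuousP cf.
by apply/continuousP => O /prod_cs_open_prod /cf.
Qed.

End Product.

Theorem theorem11 (I : Type) (C : I -> continuitySpace) :
  opens (cs_topology (prod_cs C)) =
    opens (prod_topology (fun i => cs_topology (C i)))
    :> set_system (forall i, C i) /\
  is_cs_product (P := prod_cs C) (fun (i : I) (x : forall i, C i) => x i).
Proof.
split; first exact: opens_prod_cs.
split=> [i|Z f mf]; first exact/cs_morphismP/continuous_prod_cs_coord.
exists (fun z i => f i z); split.
  split=> //; apply/cs_morphismP.
  by apply: continuous_to_prod_cs => i; exact/cs_morphismP.
by move=> g [_ gE]; apply/funext => z; apply/functional_extensionality_dep => i.
Qed.
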